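(* Let $n\ge 3$ be an integer and $0<r<1$. Let $s,h\in\mathbb{R}$ with $s\neq r$, and put $$x=\frac{s+(r-s)\cos\frac{2\pi}{n}}{\cos\frac{\pi}{n}},\qquad z=\frac{h}{r-s}\Big(r-x\cos\tfrac{\pi}{n}\Big).$$ Let $\boldsymbol{p}$ be the quadratic triangular Bézier patch with control points $$\boldsymbol{b}_{2,0,0}=(0,0,\sqrt{1-r^2}+h),\quad \boldsymbol{b}_{0,2,0}=\big(r\cos\tfrac{\pi}{n},-r\sin\tfrac{\pi}{n},\sqrt{1-r^2}\big),\quad \boldsymbol{b}_{0,0,2}=\big(r\cos\tfrac{\pi}{n},r\sin\tfrac{\pi}{n},\sqrt{1-r^2}\big),$$ $$\boldsymbol{b}_{0,1,1}=(x,0,\sqrt{1-r^2}+z),\quad \boldsymbol{b}_{1,1,0}=\big(s\cos\tfrac{\pi}{n},-s\sin\tfrac{\pi}{n},\sqrt{1-r^2}+h\big),\quad \boldsymbol{b}_{1,0,1}=\big(s\cos\tfrac{\pi}{n},s\sin\tfrac{\pi}{n},\sqrt{1-r^2}+h\big).$$ Let $\Pi$ be the plane through the origin, $\boldsymbol{b}_{0,2,0}$ and $\boldsymbol{b}_{0,0,2}$. Suppose that $\boldsymbol{b}_{0,1,1}\in\Pi$, that $\boldsymbol{b}_{0,2,0},\boldsymbol{b}_{0,1,1},\boldsymbol{b}_{0,0,2}$ are not collinear, and that $\boldsymbol{b}_{1,1,0},\boldsymbol{b}_{1,0,1},\boldsymbol{b}_{2,0,0}$ lie in the same open half-space determined by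 $\Pi$. Then the spline formed by $\boldsymbol{p}$ and its mirror image across $\Pi$ is not $G^1$ continuous along their common boundary curve (the quadratic Bézier curve with control points $\boldsymbol{b}_{0,0,2},\boldsymbol{b}_{0,1,1},\boldsymbol{b}_{0,2,0}$).
   Context: Let $\Delta=\{(\xi,\eta)\in\mathbb{R}^2: \xi,\eta\ge 0,\ \xi+\eta\le 1\}$. The quadratic triangular Bézier patch with control points $\boldsymbol{b}_{i,j,k}\in\mathbb{R}^3$, $i+j+k=2$, $i,j,k\ge0$, is the map $\boldsymbol{p}:\Delta\to\mathbb{R}^3$, $\boldsymbol{p}(\xi,\eta)=\sum_{i+j+k=2}\frac{2}{i!\,j!\,k!}\xi^i\eta^j(1-\xi-\eta)^k\boldsymbol{b}_{i,j,k}$. The mirror image of $\boldsymbol{p}$ across $\Pi$ is the patch $\boldsymbol{q}$ whose control points are the reflections in $\Pi$ of the control points of $\boldsymbol{p}$. Two patches with a common boundary curve are $G^1$ continuous along it if at every point of the curve its tangent vector and the cross-boundary first partial derivatives of the two patches are coplanar, i.e. the tangent planes coincide along the curve. Here the common boundary curve is $\boldsymbol{p}(0,\eta)=\boldsymbol{q}(0,\eta)$, $\eta\in[0,1]$, and the condition is that $\frac{\partial\boldsymbol{p}}{\partial\eta}(0,\eta)$, $\frac{\partial\boldsymbol{p}}{\partial\xi}(0,\eta)$, $\frac{\partial\boldsymbol{q}}{\partial\xi}(0,\eta)$ are linearly dependent for all $\eta\in[0,1]$. *)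

(* Defs.v *)
From HB Require Import structures.
From mathcomp Require Import all_boot all_order all_algebra.
From mathcomp Require Import all_classical all_reals all_analysis.

Set Implicit Arguments.
Unset Strict Implicit.
Unset Printing Implicit Defensive.

Import Order.TTheory GRing.Theory Num.Theory.
Import numFieldNormedType.Exports.

Local Open Scope ring_scope.

Definition point3 (R : realType) (x y z : R) : 'rV[R]_3 :=
  \row_(i < 3) [:: x; y; z]`_i.

Definition dot (R : realType) (u v : 'rV[R]_3) : R :=
  \sum_(i < 3) u 0 i * v 0 i.

Definition cross (R : realType) (u v : 'rV[R]_3) : 'rV[R]_3 :=
  let u0 := u 0 (inord 0) in let u1 := u 0 (inord 1) in
  let u2 := u 0 (inord 2) in
  let v0 := v 0 (inord 0) in let v1 := v 0 (inord 1) in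
  let v2 := v 0 (inord 2) in
  point3 (u1 * v2 - u2 * v1) (u2 * v0 - u0 * v2) (u0 * v1 - u1 * v0).

(* The next three definitions concern the plane through the origin, u and v;
   they are meaningful when u and v are linearly independent, so that
   cross u v is a nonzero normal vector. *)
Definition plane0 (R : realType) (u v : 'rV[R]_3) : {vspace 'rV[R]_3} :=
  <<[:: u; v]>>%VS.

Definition reflection0 (R : realType) (u v w : 'rV[R]_3) : 'rV[R]_3 :=
  let N := cross u v in w - (2 * dot w N / dot N N) *: N.

Definition same_open_half_space0 (R : realType) (u v : 'rV[R]_3)
    (ws : seq 'rV[R]_3) : Prop :=
  let N := cross u v in
  (forall w, w \in ws -> 0 < dot w N) \/ (forall w, w \in ws -> dot w N < 0).

Definition collinear (R : realType) (ws : seq 'rV[R]_3) : Prop :=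
  exists a d : 'rV[R]_3,
    d != 0 /\ forall w, w \in ws -> exists t : R, w = a + t *: d.

(* Only the values b i j k with i + j + k = 2 matter.  The patch is given by
   its polynomial extension to the whole plane, so that the partial
   derivatives at all boundary points of the domain triangle, including its
   vertices, are ordinary ones. *)
Definition bezier_patch (R : realType) (b : nat -> nat -> nat -> 'rV[R]_3)
    (xi eta : R) : 'rV[R]_3 :=
  \sum_(i < 3) \sum_(j < 3) \sum_(k < 3 | (i + j + k == 2)%N)
    (2 / (i`! * j`! * k`!)%:R * xi ^+ i * eta ^+ j * (1 - xi - eta) ^+ k)
      *: b i j k.

Definition mirror_net (R : realType) (u v : 'rV[R]_3)
    (b : nat -> nat -> nat -> 'rV[R]_3) (i j k : nat) : 'rV[R]_3 :=
  reflection0 u v (b i j k).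

Definition partial_xi (R : realType) (p : R -> R -> 'rV[R]_3) (xi eta : R) :
    'rV[R]_3 :=
  derive1 (fun t => p t eta) xi.

Definition partial_eta (R : realType) (p : R -> R -> 'rV[R]_3) (xi eta : R) :
    'rV[R]_3 :=
  derive1 (fun t => p xi t) eta.

(* For patches p and q with common boundary curve p 0 eta = q 0 eta,
   0 <= eta <= 1. *)
Definition G1_continuous (R : realType) (p q : R -> R -> 'rV[R]_3) : Prop :=
  forall eta : R, 0 <= eta <= 1 ->
    ~~ free [:: partial_eta p 0 eta; partial_xi p 0 eta; partial_xi q 0 eta].

(* Main.v *)
(* Write t for the tangent of the common curve, v for the cross derivative of p
   and N for a normal of Pi.  The cross derivative of the mirror image is the
   reflection v' = v - 2 (v.N / N.N) N, so det(t, v, v') is a multiple of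
   v.N det(t, v, N); the half-space condition makes v.N nonzero, and G1
   continuity forces det(t, v, N) = 0 for all eta.  This is a quadratic
   polynomial in eta whose leading coefficient is, up to a nonzero factor,
   (r cos(pi/n) - x) (r - 2 s).  If r = 2 s, the formula for x gives
   x = r cos(pi/n) anyway; then b_{0,1,1} in Pi forces z = 0, and b_{0,1,1} is
   the midpoint of b_{0,2,0} and b_{0,0,2}, against non-collinearity. *)
Require Import Defs.
From HB Require Import structures.
From mathcomp Require Import all_boot all_order all_algebra.
From mathcomp Require Import all_classical all_reals all_analysis.
From mathcomp Require Import ring lra.

Set Implicit Arguments.
Unset Strict Implicit.
Unset Printing Implicit Defensive.

Import Order.TTheory GRing.Theory Num.Theory.
Import numFieldNormedType.Exports.

Local Open Scope ring_scope.

(** A quadratic patch is quadratic in each variable separately, so both of its partial derivatives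
    are instances of this formula. *)
Lemma derive1_quadratic_mx (R : realType) m n (A B C : 'M[R]_(m, n)) (t : R) :
  derive1 (fun u : R => A + u *: B + u ^+ 2 *: C) t = B + (2 * t) *: C.
Proof.
have D i j : is_derive t 1 (fun u : R => (A + u *: B + u ^+ 2 *: C) i j)
    ((B + (2 * t) *: C) i j).
  have -> : (fun u : R => (A + u *: B + u ^+ 2 *: C) i j) =
            (fun u => A i j + u * B i j + u ^+ 2 * C i j).
    by apply/funext => u; rewrite !mxE.
  apply: is_derive_eq; rewrite !mxE /GRing.scale /=; ring.
rewrite derive1E derive_mx; last first.
  by apply/derivable_mxP => i j; exact: ex_derive.
by apply/matrixP => i j; rewrite mxE; exact: derive_val.
Qed.

(** * Vector algebra in coordinates *)

Section Point3.
Context {R : realType}.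
Implicit Types u v w : 'rV[R]_3.

Lemma point3P u : exists x y z, u = point3 x y z.
Proof.
exists (u 0 (inord 0)), (u 0 (inord 1)), (u 0 (inord 2)).
by apply/rowP => -[[|[|[|//]]] ?]; rewrite mxE /=; congr (u _ _);
  apply: val_inj; rewrite /= inordK.
Qed.

Lemma point3D (x y z x' y' z' : R) :
  point3 x y z + point3 x' y' z' = point3 (x + x') (y + y') (z + z').
Proof. by apply/rowP => -[[|[|[|//]]] ?]; rewrite !mxE. Qed.

Lemma point3Z k x y z :
  k *: point3 x y z = point3 (k * x) (k * y) (k * z) :> 'rV[R]_3.
Proof. by apply/rowP => -[[|[|[|//]]] ?]; rewrite !mxE. Qed.

Lemma point3N x y z : - point3 x y z = point3 (- x) (- y) (- z) :> 'rV[R]_3.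
Proof. by apply/rowP => -[[|[|[|//]]] ?]; rewrite !mxE. Qed.

Lemma dot_point3 (x y z x' y' z' : R) :
  dot (point3 x y z) (point3 x' y' z') = x * x' + y * y' + z * z'.
Proof. by rewrite /dot !big_ord_recr big_ord0 /= !mxE /= add0r. Qed.

Lemma cross_point3 (x y z x' y' z' : R) :
  cross (point3 x y z) (point3 x' y' z') =
  point3 (y * z' - z * y') (z * x' - x * z') (x * y' - y * x').
Proof. by rewrite /cross !mxE !inordK. Qed.

Definition point3L := (point3D, point3N, point3Z).

Lemma dotDl u v w : dot (u + v) w = dot u w + dot v w.
Proof.
by rewrite /dot -big_split; apply: eq_bigr => i _; rewrite mxE mulrDl.
Qed.

Lemma dotZl k u w : dot (k *: u) w = k * dot u w.
Proof.
by rewrite /dot mulr_sumr; apply: eq_bigr => i _; rewrite mxE mulrA.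
Qed.

Lemma dotNl u w : dot (- u) w = - dot u w.
Proof. by rewrite -scaleN1r dotZl mulN1r. Qed.

Lemma dot0l w : dot 0 w = 0.
Proof. by rewrite /dot big1 // => i _; rewrite mxE mul0r. Qed.

(** Cramer's rule, by contraposition: pairing a vanishing combination with v x w, w x u and u x v in
    turn kills two terms and leaves one coefficient times the determinant. *)
Lemma triple_eq0 u v w : ~~ free [:: u; v; w] -> dot u (cross v w) = 0.
Proof.
move=> nf; apply/eqP; apply: contraNT nf => d0.
apply/(@freeP _ _ 3 [tuple u; v; w]) => k.
rewrite !big_ord_recr big_ord0 /= add0r.
set k0 := k _; set k1 := k _; set k2 := k _ => k_eq0.
have [k0_eq0 k1_eq0 k2_eq0] : [/\ k0 = 0, k1 = 0 & k2 = 0].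
  move: d0 k_eq0; case: (point3P u) => u0 [u1 [u2 ->]].
  case: (point3P v) => v0 [v1 [v2 ->]]; case: (point3P w) => w0 [w1 [w2 ->]].
  rewrite ?point3L ?cross_point3 ?dot_point3 => d0 k_eq0.
  have k_dot (a b c : R) := congr1 (fun y => dot y (point3 a b c)) k_eq0.
  split; apply: (mulIf d0); rewrite mul0r.
  - have := k_dot (v1 * w2 - v2 * w1) (v2 * w0 - v0 * w2) (v0 * w1 - v1 * w0).
    by rewrite /= dot0l dot_point3 => <-; ring.
  - have := k_dot (w1 * u2 - w2 * u1) (w2 * u0 - w0 * u2) (w0 * u1 - w1 * u0).
    by rewrite /= dot0l dot_point3 => <-; ring.
  - have := k_dot (u1 * v2 - u2 * v1) (u2 * v0 - u0 * v2) (u0 * v1 - u1 * v0).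
    by rewrite /= dot0l dot_point3 => <-; ring.
by case=> [[|[|[|//]]] ?]; [rewrite -[RHS]k0_eq0 | rewrite -[RHS]k1_eq0
  | rewrite -[RHS]k2_eq0]; congr (k _); exact: val_inj.
Qed.

Lemma reflection0Z u v k w : reflection0 u v (k *: w) = k *: reflection0 u v w.
Proof. by rewrite /reflection0 dotZl scalerBr scalerA mulrCA !mulrA. Qed.

Lemma reflection0D u v w w' :
  reflection0 u v (w + w') = reflection0 u v w + reflection0 u v w'.
Proof. by rewrite /reflection0 dotDl mulrDr mulrDl scalerDl opprD addrACA. Qed.

Lemma reflection0N u v w : reflection0 u v (- w) = - reflection0 u v w.
Proof. by rewrite -scaleN1r reflection0Z scaleN1r. Qed.

Lemma dot_plane0 u v w : w \in plane0 u v -> dot w (cross u v) = 0.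
Proof.
rewrite /plane0 span_cons span_seq1 => /memv_addP[_ /vlineP[k ->]].
case=> _ /vlineP[l ->] ->; rewrite dotDl !dotZl.
case: (point3P u) => u0 [u1 [u2 ->]]; case: (point3P v) => v0 [v1 [v2 ->]].
by rewrite ?point3L ?cross_point3 ?dot_point3; ring.
Qed.

(** * Derivatives of a patch along the edge xi = 0 *)

Lemma bezier_patchE b (xi eta : R) (k := 1 - xi - eta) :
  bezier_patch b xi eta =
    xi ^+ 2 *: b 2%N 0%N 0%N + eta ^+ 2 *: b 0%N 2%N 0%N
    + k ^+ 2 *: b 0%N 0%N 2%N
    + (2 * xi * eta) *: b 1%N 1%N 0%N + (2 * xi * k) *: b 1%N 0%N 1%N
    + (2 * eta * k) *: b 0%N 1%N 1%N.
Proof.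
rewrite /bezier_patch.
under eq_bigr do under eq_bigr do rewrite big_mkcond /=.
rewrite !big_ord_recr !big_ord0 /= !factS !fact0 -/k.
apply/rowP => i; rewrite !mxE !(muln1, mul1n) divr1.
by field.
Qed.

Lemma partial_xi_bezier_patch b (eta : R) :
  partial_xi (bezier_patch b) 0 eta =
  2 *: ((1 - eta) *: (b 1%N 0%N 1%N - b 0%N 0%N 2%N)
        + eta *: (b 1%N 1%N 0%N - b 0%N 1%N 1%N)).
Proof.
(* [C] is the coefficient of xi^2 in the patch; its contribution to the derivative vanishes at xi =
   0. *)
set B := RHS; pose C := b 2%N 0%N 0%N + b 0%N 0%N 2%N - 2 *: b 1%N 0%N 1%N.
rewrite -[B](_ : B + (2 * 0) *: C = B); last by rewrite mulr0 scale0r addr0.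
rewrite /partial_xi -(derive1_quadratic_mx (eta ^+ 2 *: b 0%N 2%N 0%N
  + (1 - eta) ^+ 2 *: b 0%N 0%N 2%N + (2 * eta * (1 - eta)) *: b 0%N 1%N 1%N)).
congr (derive1 _ 0); apply/funext => xi; rewrite bezier_patchE /B /C.
by apply/rowP => i; rewrite !mxE; ring.
Qed.

Lemma partial_eta_bezier_patch b (eta : R) :
  partial_eta (bezier_patch b) 0 eta =
  2 *: ((1 - eta) *: (b 0%N 1%N 1%N - b 0%N 0%N 2%N)
        + eta *: (b 0%N 2%N 0%N - b 0%N 1%N 1%N)).
Proof.
set D := RHS.
have -> : D = 2 *: (b 0%N 1%N 1%N - b 0%N 0%N 2%N)
    + (2 * eta) *: (b 0%N 2%N 0%N + b 0%N 0%N 2%N - 2 *: b 0%N 1%N 1%N).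
  by apply/rowP => i; rewrite !mxE; ring.
rewrite /partial_eta -(derive1_quadratic_mx (b 0%N 0%N 2%N)).
congr (derive1 _ eta); apply/funext => t; rewrite bezier_patchE.
by apply/rowP => i; rewrite !mxE; ring.
Qed.

(** * The mirror image and the determinant condition *)

Lemma partial_xi_mirror_net u v b (eta : R) :
  partial_xi (bezier_patch (mirror_net u v b)) 0 eta =
  reflection0 u v (partial_xi (bezier_patch b) 0 eta).
Proof.
rewrite !partial_xi_bezier_patch /mirror_net.
by rewrite !(reflection0D, reflection0N, reflection0Z).
Qed.

(** The reflected vector is w - a N for a scalar a, and w x (w - a N) = - a (w x N). *)
Lemma triple_reflection0 u v t w (N := cross u v) :
  dot t (cross w (reflection0 u v w)) =
  - (2 * dot w N / dot N N) * dot t (cross w N).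
Proof.
rewrite /reflection0 -/N; move: (_ / _) => a.
case: (point3P t) => t0 [t1 [t2 ->]]; case: (point3P w) => w0 [w1 [w2 ->]].
case: (point3P N) => n0 [n1 [n2 ->]].
by rewrite ?point3L ?cross_point3 ?dot_point3; ring.
Qed.

Lemma G1_mirror_triple u v b (N := cross u v) :
    dot N N != 0 ->
    same_open_half_space0 u v [:: b 1%N 1%N 0%N; b 1%N 0%N 1%N] ->
    b 0%N 2%N 0%N \in plane0 u v -> b 0%N 1%N 1%N \in plane0 u v ->
    b 0%N 0%N 2%N \in plane0 u v ->
    G1_continuous (bezier_patch b) (bezier_patch (mirror_net u v b)) ->
  forall eta, 0 <= eta <= 1 ->
  dot (partial_eta (bezier_patch b) 0 eta)
      (cross (partial_xi (bezier_patch b) 0 eta) N) = 0.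
Proof.
move=> N0 side /dot_plane0 p020 /dot_plane0 p011 /dot_plane0 p002 G1 eta eta01.
have := triple_eq0 (G1 eta eta01); rewrite partial_xi_mirror_net.
rewrite triple_reflection0 => /eqP; rewrite mulf_eq0 oppr_eq0 => /orP[|/eqP//].
rewrite !mulf_eq0 invr_eq0 (negPf N0) orbF (pnatr_eq0 _ 2) /= => /eqP.
rewrite partial_xi_bezier_patch !(dotDl, dotNl, dotZl) -/N p011 p002.
rewrite !oppr0 !addr0.
(* What is left of the cross derivative along [N] is a convex combination, up to the factor 2, of
   the values at the control points 110 and 101. These have the same strict sign, so it cannot
   vanish. *)
case: side => side.
- have := side (b 1%N 1%N 0%N); have := side (b 1%N 0%N 1%N).
  rewrite !inE !eqxx orbT => /(_ isT) + /(_ isT); nra.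
- have := side (b 1%N 1%N 0%N); have := side (b 1%N 0%N 1%N).
  rewrite !inE !eqxx orbT => /(_ isT) + /(_ isT); nra.
Qed.

(** Tangent and cross derivative are affine in eta; the two differences of control points paired
    here are half their slopes. *)
Lemma G1_mirror_leading_coef u v b (N := cross u v) :
    dot N N != 0 ->
    same_open_half_space0 u v [:: b 1%N 1%N 0%N; b 1%N 0%N 1%N] ->
    b 0%N 2%N 0%N \in plane0 u v -> b 0%N 1%N 1%N \in plane0 u v ->
    b 0%N 0%N 2%N \in plane0 u v ->
    G1_continuous (bezier_patch b) (bezier_patch (mirror_net u v b)) ->
  dot (b 0%N 2%N 0%N + b 0%N 0%N 2%N - 2 *: b 0%N 1%N 1%N)
      (cross (b 1%N 1%N 0%N - b 0%N 1%N 1%N - b 1%N 0%N 1%N + b 0%N 0%N 2%N) N)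
  = 0.
Proof.
move=> N0 side p020 p011 p002 G1.
have F := G1_mirror_triple N0 side p020 p011 p002 G1.
(* The determinant is quadratic in eta; its leading coefficient is read off
   from the values at 0, 1/2 and 1. *)
pose f (eta : R) := dot (partial_eta (bezier_patch b) 0 eta)
  (cross (partial_xi (bezier_patch b) 0 eta) N).
(* For a quadratic f with leading coefficient a, f(0) + f(1) - 2 f(1/2) = a/2. Here a is 4 times the
   wanted value, each partial derivative contributing a factor 2; hence the [2^-1]. *)
transitivity (2^-1 * (f 0 + f 1 - 2 * f 2^-1)); last first.
  have f0 : f 0 = 0 by apply: F; rewrite lexx ler01.
  have f1 : f 1 = 0 by apply: F; rewrite lexx ler01.
  have fh : f 2^-1 = 0 by apply: F; rewrite invr_ge0 ler0n invf_le1 ?ler1n.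
  by rewrite f0 f1 fh; ring.
rewrite /f !partial_xi_bezier_patch !partial_eta_bezier_patch.
case: (point3P N) => n0 [n1 [n2 ->]].
case: (point3P (b 0%N 2%N 0%N)) => x0 [y0 [z0 ->]].
case: (point3P (b 0%N 1%N 1%N)) => x1 [y1 [z1 ->]].
case: (point3P (b 0%N 0%N 2%N)) => x2 [y2 [z2 ->]].
case: (point3P (b 1%N 1%N 0%N)) => x3 [y3 [z3 ->]].
case: (point3P (b 1%N 0%N 1%N)) => x4 [y4 [z4 ->]].
by rewrite ?point3L ?cross_point3 ?dot_point3; field.
Qed.

End Point3.

(** * The given control net *)

Theorem mainTheorem5 (R : realType) (n : nat) (r s h x z : R)
  (b : nat -> nat -> nat -> 'rV[R]_3)
  (hn : (3 <= n)%N) (hr : 0 < r < 1) (hsr : s != r)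
  (hx : x = (s + (r - s) * cos (2 * pi / n%:R)) / cos (pi / n%:R))
  (hz : z = h / (r - s) * (r - x * cos (pi / n%:R)))
  (hb200 : b 2%N 0%N 0%N = point3 0 0 (Num.sqrt (1 - r ^+ 2) + h))
  (hb020 : b 0%N 2%N 0%N =
     point3 (r * cos (pi / n%:R)) (- (r * sin (pi / n%:R)))
            (Num.sqrt (1 - r ^+ 2)))
  (hb002 : b 0%N 0%N 2%N =
     point3 (r * cos (pi / n%:R)) (r * sin (pi / n%:R))
            (Num.sqrt (1 - r ^+ 2)))
  (hb011 : b 0%N 1%N 1%N = point3 x 0 (Num.sqrt (1 - r ^+ 2) + z))
  (hb110 : b 1%N 1%N 0%N =
     point3 (s * cos (pi / n%:R)) (- (s * sin (pi / n%:R)))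
            (Num.sqrt (1 - r ^+ 2) + h))
  (hb101 : b 1%N 0%N 1%N =
     point3 (s * cos (pi / n%:R)) (s * sin (pi / n%:R))
            (Num.sqrt (1 - r ^+ 2) + h))
  (hplane : b 0%N 1%N 1%N \in plane0 (b 0%N 2%N 0%N) (b 0%N 0%N 2%N))
  (hncol : ~ collinear [:: b 0%N 2%N 0%N; b 0%N 1%N 1%N; b 0%N 0%N 2%N])
  (hside : same_open_half_space0 (b 0%N 2%N 0%N) (b 0%N 0%N 2%N)
             [:: b 1%N 1%N 0%N; b 1%N 0%N 1%N; b 2%N 0%N 0%N]) :
  ~ G1_continuous (bezier_patch b)
      (bezier_patch (mirror_net (b 0%N 2%N 0%N) (b 0%N 0%N 2%N) b)).
Proof.
have n0 : 0 < n%:R :> R by rewrite ltr0n (leq_trans _ hn).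
have pn_gt0 : 0 < pi / n%:R :> R by rewrite divr_gt0 ?pi_gt0.
have pn_lt : pi / n%:R < pi / 2 :> R.
  by rewrite ltr_pM2l ?pi_gt0 // ltf_pV2 ?posrE // ltr_nat.
have sin0 : 0 < sin (pi / n%:R) :> R by rewrite sin_gt0_pihalf // pn_gt0.
have cos0 : 0 < cos (pi / n%:R) :> R.
  by rewrite cos_gt0_pihalf // pn_lt andbT (lt_trans _ pn_gt0) // oppr_lt0
    divr_gt0 ?pi_gt0.
have cos2 : cos (2 * pi / n%:R) = 2 * cos (pi / n%:R) ^+ 2 - 1 :> R.
  by rewrite -mulrA mulr_natl cos_mulr2n mulr_natl.
move: hx hz hb020 hb002 hb110 hb101; rewrite cos2.
have w0 : 0 < Num.sqrt (1 - r ^+ 2).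
  by rewrite sqrtr_gt0; case/andP: hr => ? ?; nra.
(* The double angle formula made [x] rational in cos(pi/n). From here on the cosine, sine and root
   are arbitrary positive reals [c], [sg], [w]. *)
move: (cos _) (sin _) (Num.sqrt _) cos0 sin0 w0 hb200 hb011.
case/andP: hr => r0 _ {cos2 pn_lt pn_gt0}.
move=> c sg w cos0 sin0 w0 hb200 hb011 hx hz hb020 hb002 hb110 hb101 G1.
have Ne : cross (b 0%N 2%N 0%N) (b 0%N 0%N 2%N) =
    (2 * r * sg) *: point3 (- w) 0 (r * c).
  by rewrite hb020 hb002 ?point3L ?cross_point3 ?dot_point3; congr point3; ring.
have xz : - w * x + r * c * (w + z) = 0.
  have := dot_plane0 hplane; rewrite Ne hb011 !point3L dot_point3.
  move=> e; apply: (@mulfI _ (2 * r * sg)); first by rewrite !mulf_neq0 ?gt_eqF.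
  by rewrite mulr0 -[RHS]e; ring.
have Nn0 : dot (cross (b 0%N 2%N 0%N) (b 0%N 0%N 2%N))
    (cross (b 0%N 2%N 0%N) (b 0%N 0%N 2%N)) != 0.
  rewrite Ne ?point3L ?cross_point3 ?dot_point3 mulr0 mul0r addr0 -!expr2.
  by rewrite gt_eqF // ltr_wpDr ?sqr_ge0 // exprn_even_gt0 //= mulf_neq0 //
    ?oppr_eq0 ?gt_eqF // !mulr_gt0.
have lead : (r * c - x) * (r - 2 * s) = 0.
  have side : same_open_half_space0 (b 0%N 2%N 0%N) (b 0%N 0%N 2%N)
      [:: b 1%N 1%N 0%N; b 1%N 0%N 1%N].
    by case: hside => H; [left|right] => v; rewrite !inE => /orP[]/eqP->;
      apply: H; rewrite !inE eqxx ?orbT.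
  have memu : b 0%N 2%N 0%N \in plane0 (b 0%N 2%N 0%N) (b 0%N 0%N 2%N).
    by apply: memv_span; rewrite !inE eqxx.
  have memv : b 0%N 0%N 2%N \in plane0 (b 0%N 2%N 0%N) (b 0%N 0%N 2%N).
    by apply: memv_span; rewrite !inE eqxx orbT.
  have := G1_mirror_leading_coef Nn0 side memu hplane memv G1.
  rewrite Ne hb020 hb002 hb011 hb110 hb101.
  rewrite !point3L cross_point3 dot_point3 => E.
  (* This positive factor times the goal is [r * c] times the determinant in [E], once [z] is
     eliminated by the plane equation [xz]; the multiplier [r * c] clears the denominator of [z]. *)
  apply: (@mulfI _ (4 * r * sg ^+ 2 * ((r * c) ^+ 2 + w ^+ 2))).
    by rewrite gt_eqF // !(mulr_gt0, exprn_gt0, addr_gt0).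
  rewrite mulr0 -[RHS](mulr0 (r * c)) -[in RHS]E.
  have zE : z = w * x / (r * c) - w.
    apply: (@mulfI _ (r * c)); first by rewrite gt_eqF // mulr_gt0.
    rewrite mulrBr mulrCA mulfV ?mulr1 ?gt_eqF ?mulr_gt0 //.
    by apply/eqP; rewrite -subr_eq0 -xz; apply/eqP; ring.
  by rewrite zE; field; rewrite !gt_eqF.
have xE : x = r * c.
  move/eqP: lead; rewrite mulf_eq0 => /orP[|]/eqP; first by move/subr0_eq.
  (* With r = 2 s the numerator of [x] is s + s (2 c^2 - 1) = 2 s c^2. *)
  move=> rs; rewrite hx (_ : r = 2 * s); last exact: subr0_eq.
  by field; rewrite gt_eqF.
have z_eq0 : z = 0.
  apply: (@mulfI _ (r * c)); first by rewrite gt_eqF // mulr_gt0.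
  by rewrite mulr0 -xz xE; ring.
apply: hncol; rewrite hb020 hb011 hb002.
(* The line through the control point 020 parallel to the y-axis; the points 020, 011, 002 have
   parameters 0, [r * sg], [2 * r * sg]. *)
exists (point3 (r * c) (- (r * sg)) w), (point3 0 1 0); split.
  apply/eqP => /(congr1 (fun v => dot v (point3 0 1 0))) /eqP.
  by rewrite dot0l dot_point3 !mul0r mulr1 add0r addr0 oner_eq0.
move=> v; rewrite !inE => /or3P[]/eqP->;
  [exists 0 | exists (r * sg) | exists (2 * r * sg)];
  by rewrite !point3L; congr point3; rewrite ?xE ?z_eq0; ring.
Qed.
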